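(* For all integers $n \ge 2$ and all primes $p$, there exist an integer $d \ge 1$ and a representation (group homomorphism) $\rho\colon F_n \to \mathrm{GL}_d(\mathbb{Z})$ with infinite image such that every element of $\rho(\mathfrak{O}_p)$ has finite order.
   Context: $F_n$ is the free group on $n$ generators and $\mathbb{F}_p$ is the field with $p$ elements. An element $x \in F_n$ is $p$-primitive if it maps to a nonzero element of $H_1(F_n;\mathbb{F}_p)$; $\mathfrak{O}_p \subset F_n$ denotes the set of $p$-primitive elements. *)

(* Defs.v *)
From HB Require Import structures.
From mathcomp Require Import all_boot all_order all_algebra.
From mathcomp Require Import boolp classical_sets functions cardinality.
From mathcomp Require Import finmap monalg.

Set Implicit Arguments.
Unset Strict Implicit.
Unset Printing Implicit Defensive.

Import GRing.Theory.

(* The free group on [X], realized as reduced words: the letter [(x, false)]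
   is the generator x, and [(x, true)] is its inverse. *)
Section FreeGroup.
Variable X : choiceType.
Implicit Types (a b : X * bool) (u v w : seq (X * bool)).

Definition letter_inv a : X * bool := (a.1, ~~ a.2).

Definition reduced w := sorted [rel a b | b != letter_inv a] w.

Definition letter_mul a w :=
  if w is b :: w' then (if b == letter_inv a then w' else a :: w) else [:: a].

Definition word_mul u v := foldr letter_mul v u.

Definition word_inv w := rev (map letter_inv w).

Lemma letter_invK : involutive letter_inv.
Proof. by case=> x b; rewrite /letter_inv /= negbK. Qed.

Lemma letter_mul_reduced a w : reduced w -> reduced (letter_mul a w).
Proof.
case: w => [//|b w] red_bw /=; case: ifPn => [_|ne_ba]; first exact: path_sorted red_bw.
by rewrite /reduced /= ne_ba.
Qed.

Lemma letter_mul_cons a w : reduced (a :: w) -> letter_mul a w = a :: w.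
Proof. by case: w => [//|b w] /= /andP[/negPf-> _]. Qed.

Lemma letter_mulK a w :
  reduced w -> letter_mul (letter_inv a) (letter_mul a w) = w.
Proof.
case: w => [_|b w red_bw] /=; first by rewrite letter_invK eqxx.
case: ifPn => [/eqP <-|_] /=; first exact: letter_mul_cons.
by rewrite letter_invK eqxx.
Qed.

Lemma word_mul_reduced u v : reduced v -> reduced (word_mul u v).
Proof. by move=> red_v; elim: u => //= a u; apply: letter_mul_reduced. Qed.

Lemma word_mul_letter a u v : reduced v ->
  word_mul (letter_mul a u) v = letter_mul a (word_mul u v).
Proof.
case: u => [//|b u] red_v /=; case: ifPn => [/eqP->|//].
by rewrite -[LHS](letter_mulK (letter_inv a)) ?letter_invK ?word_mul_reduced.
Qed.

Lemma word_mulA u v w : reduced w ->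
  word_mul u (word_mul v w) = word_mul (word_mul u v) w.
Proof. by move=> red_w; elim: u => //= a u ->; rewrite word_mul_letter. Qed.

Lemma word_mul1 w : reduced w -> word_mul w [::] = w.
Proof.
elim: w => //= a w IHw red_aw.
by rewrite IHw ?letter_mul_cons //; exact: path_sorted red_aw.
Qed.

Lemma word_invK : involutive word_inv.
Proof.
by move=> w; rewrite /word_inv map_rev revK -map_comp map_id_in // => a _ /=;
   rewrite letter_invK.
Qed.

Lemma word_inv_reduced w : reduced w -> reduced (word_inv w).
Proof.
rewrite /reduced /word_inv rev_sorted sorted_map; apply: sub_sorted => a b /=.
by apply: contra => /eqP ->; rewrite letter_invK.
Qed.

Lemma word_mulV w : word_mul (word_inv w) w = [::].
Proof.
elim: w => //= a w IHw.
by rewrite /word_inv /= rev_cons /word_mul foldr_rcons /= letter_invK eqxx.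
Qed.

Record freeGroup := FreeGroup {
  freeGroup_word :> seq (X * bool);
  freeGroup_reduced : reduced freeGroup_word
}.

HB.instance Definition _ := [isSub for freeGroup_word].
HB.instance Definition _ := [Choice of freeGroup by <:].

Definition freeGroup_one : freeGroup := @FreeGroup [::] isT.
Definition freeGroup_mul (g h : freeGroup) : freeGroup :=
  FreeGroup (word_mul_reduced g (freeGroup_reduced h)).
Definition freeGroup_inv (g : freeGroup) : freeGroup :=
  FreeGroup (word_inv_reduced (freeGroup_reduced g)).

Fact freeGroup_mulA : associative freeGroup_mul.
Proof.
by move=> f g h; apply: val_inj; apply: word_mulA; exact: freeGroup_reduced.
Qed.

Fact freeGroup_mul1g : left_id freeGroup_one freeGroup_mul.
Proof. by move=> g; apply: val_inj. Qed.

Fact freeGroup_mulg1 : right_id freeGroup_one freeGroup_mul.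
Proof. by move=> g; apply/val_inj/word_mul1/freeGroup_reduced. Qed.

Fact freeGroup_mulVg : left_inverse freeGroup_one freeGroup_inv freeGroup_mul.
Proof. by move=> g; apply/val_inj/word_mulV. Qed.

Fact freeGroup_mulgV : right_inverse freeGroup_one freeGroup_inv freeGroup_mul.
Proof.
by move=> g; apply: val_inj; rewrite /= -{1}(word_invK g); exact: word_mulV.
Qed.

HB.instance Definition _ := isGroup.Build freeGroup freeGroup_mulA
  freeGroup_mul1g freeGroup_mulg1 freeGroup_mulVg freeGroup_mulgV.

End FreeGroup.

(* First homology of a group G with trivial coefficients in R, computed from
   the inhomogeneous bar complex R[G * G] -> R[G] -> R.  With trivial
   coefficients the second map is zero, so that every 1-chain is a cycle and
   the first homology is the cokernel of the first map. *)
Section H1.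
Variables (R : nzRingType) (G : groupType).
Local Open Scope ring_scope.

Definition bar_d2 (c : {malg R[(G * G)%type]}) : {malg R[G]} :=
  \sum_(s <- msupp c)
    mcoeff s c *: (<< s.2 >> - << (s.1 * s.2)%g >> + << s.1 >>).

Lemma bar_d2_widen (S : {fset (G * G)%type}) c : (msupp c `<=` S)%fset ->
  bar_d2 c = \sum_(s <- S)
    mcoeff s c *: (<< s.2 >> - << (s.1 * s.2)%g >> + << s.1 >>).
Proof.
move=> sub; rewrite /bar_d2 [LHS](big_fset_incl _ sub) // => s _.
by rewrite -mcoeff_eq0 => /eqP ->; rewrite scale0r.
Qed.

Lemma bar_d2_zmod_morphism : zmod_morphism bar_d2.
Proof.
move=> c c'; pose S := (msupp c `|` msupp c' `|` msupp (c - c'))%fset.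
have sub1 : (msupp c `<=` S)%fset by rewrite /S -fsetUA fsubsetUl.
have sub2 : (msupp c' `<=` S)%fset by rewrite /S fsetUAC fsubsetUr.
rewrite (bar_d2_widen sub1) (bar_d2_widen sub2) (@bar_d2_widen S) ?fsubsetUr //.
by rewrite -sumrB; apply: eq_bigr => s _; rewrite mcoeffB scalerBl.
Qed.

HB.instance Definition _ :=
  GRing.isZmodMorphism.Build _ _ bar_d2 bar_d2_zmod_morphism.

Definition boundary1 : {pred {malg R[G]}} := fun b => `[< exists c, bar_d2 c = b >].

Fact boundary1_zmod_closed : zmod_closed boundary1.
Proof.
split=> [|_ _ /asboolP[c <-] /asboolP[c' <-]]; apply/asboolP.
  by exists 0; rewrite raddf0.
by exists (c - c'); rewrite raddfB.
Qed.

HB.instance Definition _ :=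
  GRing.isZmodClosed.Build {malg R[G]} boundary1 boundary1_zmod_closed.

Definition H1 : zmodType := Quotient.quot boundary1.

Definition H1_class (x : G) : H1 := (\pi_(Quotient.quot boundary1) << x >>)%qT.

End H1.

Definition p_primitive (n p : nat) : set (freeGroup 'I_n) :=
  [set x | H1_class 'F_p x <> 0%R]%classic.
Arguments p_primitive : clear implicits.

(* GL_d(R), written as a subtype because MathComp's ['GL_d[R]] requires a
   finite ring. *)
Section GL.
Variables (d : nat) (R : comUnitRingType).
Local Open Scope ring_scope.

Record GL := MkGL { GL_mx :> 'M[R]_d; GL_unit : GL_mx \in unitmx }.

HB.instance Definition _ := [isSub for GL_mx].
HB.instance Definition _ := [Choice of GL by <:].

Fact GL_mul_subproof (A B : GL) : (A : 'M_d) *m B \in unitmx.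
Proof. by rewrite unitmx_mul !GL_unit. Qed.

Fact GL_inv_subproof (A : GL) : invmx A \in unitmx.
Proof. by rewrite unitmx_inv GL_unit. Qed.

Definition GL_one : GL := MkGL (unitmx1 R d).
Definition GL_mul (A B : GL) : GL := MkGL (GL_mul_subproof A B).
Definition GL_inv (A : GL) : GL := MkGL (GL_inv_subproof A).

Fact GL_mulA : associative GL_mul.
Proof. by move=> A B C; apply/val_inj/mulmxA. Qed.
Fact GL_mul1g : left_id GL_one GL_mul.
Proof. by move=> A; apply/val_inj/mul1mx. Qed.
Fact GL_mulg1 : right_id GL_one GL_mul.
Proof. by move=> A; apply/val_inj/mulmx1. Qed.
Fact GL_mulVg : left_inverse GL_one GL_inv GL_mul.
Proof. by move=> A; apply/val_inj/mulVmx/GL_unit. Qed.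
Fact GL_mulgV : right_inverse GL_one GL_inv GL_mul.
Proof. by move=> A; apply/val_inj/mulmxV/GL_unit. Qed.

HB.instance Definition _ :=
  isGroup.Build GL GL_mulA GL_mul1g GL_mulg1 GL_mulVg GL_mulgV.

End GL.

Definition has_finite_order (G : groupType) (g : G) : Prop :=
  exists k : nat, (0 < k)%N /\ (g ^+ k = 1)%g.

(* Main.v *)
(* Let G be a finite quotient of the free group F and c a nontrivial central
   element of G that is a power of the image of every p-primitive x.  Let F act on
   the lattice Z[G] by affine maps whose linear part is the regular one and
   whose translation part lies in M = ker (1 + c + ... + c^(ord c - 1)).  A vector
   of M fixed by a p-primitive x is fixed by c, hence zero.  So if x has order N
   in G, the translation part of x^N, being fixed by x, vanishes, and x has finite
   order.  If the image of F were finite, the action would have (up to a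
   multiple) a fixed point in M; when one generator acts linearly this point is
   zero, which is impossible if another generator translates by a nonzero vector.

   To construct G, let D = p^n, let L be the field with p^D elements and choose
   e_1, ..., e_n in L linearly independent over F_p.  Send the i-th generator to
   the (D + 1)-square matrix 1 + N_i, where N_i has superdiagonal
   e_i, e_i^p, ..., e_i^(p^(D-1)).  Then x is sent to 1 + N with N strictly upper
   triangular of superdiagonal l, l^p, ..., l^(p^(D-1)), where l is the
   combination of the e_i given by the class of x, and
   (1 + N)^D = 1 + N^D = 1 + Norm(l) E, with E the elementary matrix of the upper
   right corner.  As Norm(l) is in F_p and nonzero when l is, c = 1 + E works. *)

From HB Require Import structures.
Require Import Defs.
From mathcomp Require Import all_boot all_order all_algebra.
From mathcomp Require Import all_fingroup mxrepresentation finfield.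
From mathcomp Require Import boolp classical_sets functions cardinality.
From mathcomp Require Import finmap monalg.

Set Implicit Arguments.
Unset Strict Implicit.
Unset Printing Implicit Defensive.

Import GRing.Theory Num.Theory.
Local Open Scope ring_scope.

(** * Free groups: universal property and exponent sums *)

Section FreeGroupTheory.
Variable X : choiceType.
Implicit Types (a : X * bool) (x : X) (w : freeGroup X).

Definition fg_letter a : freeGroup X := @FreeGroup X [:: a] isT.
Definition fg_gen x := fg_letter (x, false).

Lemma fg_letterV x : fg_letter (x, true) = ((fg_gen x)^-1)%g.
Proof. exact: val_inj. Qed.

Lemma freeGroup_ind (P : freeGroup X -> Prop) :
  P 1%g -> (forall a w, P w -> P (fg_letter a * w)%g) -> forall w, P w.
Proof.
move=> P1 PM [w red_w]; elim: w red_w => [|a w IHw] red_w.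
  by rewrite (_ : FreeGroup _ = 1%g) //; apply: val_inj.
have red_w' : reduced w := path_sorted red_w.
have -> : FreeGroup red_w = (fg_letter a * FreeGroup red_w')%g.
  by apply: val_inj; rewrite -[LHS](letter_mul_cons red_w).
exact/PM/IHw.
Qed.

Section Lift.
Variables (G : groupType) (f : X -> G).

Definition fg_lift_letter a : G := if a.2 then ((f a.1)^-1)%g else f a.1.

Definition fg_lift w : G := foldr (fun a g => (fg_lift_letter a * g)%g) 1%g w.

Lemma fg_lift_letterV a :
  fg_lift_letter (letter_inv a) = ((fg_lift_letter a)^-1)%g.
Proof. by case: a => x [] //=; rewrite /fg_lift_letter /= invgK. Qed.

Lemma fg_liftM : {morph fg_lift : u v / (u * v)%g}.
Proof.
case=> u red_u [v red_v]; rewrite /fg_lift /= {red_u red_v}.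
elim: u => [|a u IHu] /=; first by rewrite mul1g.
rewrite -mulgA -IHu; case: (word_mul u v) => [|b w] //=.
by case: eqP => [->|//] /=; rewrite fg_lift_letterV mulVKg.
Qed.

HB.instance Definition _ := monoid.isMultiplicative.Build _ _ fg_lift fg_liftM.
HB.instance Definition _ :=
  Multiplicative_isUMagmaMorphism.Build _ _ fg_lift erefl.

Lemma fg_liftE a : fg_lift (fg_letter a) = fg_lift_letter a.
Proof. exact: mulg1. Qed.

End Lift.

Definition exponent_sum w x : int := \sum_(a <- val w | a.1 == x) (-1) ^+ a.2.

Lemma exponent_sum_letter a x :
  exponent_sum (fg_letter a) x = if a.1 == x then (-1) ^+ a.2 else 0.
Proof. by rewrite /exponent_sum big_mkcond big_seq1. Qed.

Lemma exponent_sumM u v x :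
  exponent_sum (u * v)%g x = exponent_sum u x + exponent_sum v x.
Proof.
case: u v => u red_u [v red_v]; rewrite /exponent_sum /= {red_u red_v}.
elim: u => [|a u IHu]; first by rewrite big_nil add0r.
rewrite -[word_mul _ _]/(letter_mul a (word_mul u v)).
(* A cancelling pair contributes opposite signs, so free reduction leaves the sum unchanged. *)
suff -> (s : seq (X * bool)) :
    \sum_(b <- letter_mul a s | b.1 == x) (-1) ^+ b.2 =
    \sum_(b <- a :: s | b.1 == x) (-1) ^+ b.2 :> int.
  by rewrite !big_cons IHu; case: ifP => // _; rewrite addrA.
case: s => [//|b s] /=; case: eqP => [->|//].
rewrite [RHS]big_cons big_cons /=; case: eqP => // _.
by case: a => y [] /=; rewrite ?expr1 ?expr0 addrA ?addrN ?addNr add0r.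
Qed.

End FreeGroupTheory.

(** Applied to [H1_class], this turns homology classes into exponent sums. *)
Lemma freeGroup_additive (X : finType) (V : zmodType) (f : freeGroup X -> V) :
  (forall u v, f (u * v)%g = f u + f v) ->
  forall w, f w = \sum_x f (fg_gen x) *~ exponent_sum w x.
Proof.
move=> fM; have f1 : f 1%g = 0.
  by apply: (addrI (f 1%g)); rewrite -fM mul1g addr0.
have fV u : f (u^-1)%g = - f u.
  by apply: (addrI (f u)); rewrite -fM mulgV f1 addrN.
elim/freeGroup_ind => [|a w IHw].
  by rewrite f1 big1 // => x _; rewrite /exponent_sum big_nil mulr0z.
rewrite fM IHw; under [RHS]eq_bigr do rewrite exponent_sumM mulrzDr.
rewrite big_split /= [X in _ = X + _](_ : _ = f (fg_letter a)) //.
rewrite (bigD1 a.1) //= big1 ?addr0 => [|x nx].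
  rewrite exponent_sum_letter eqxx.
  by case: a => x []; rewrite ?fg_letterV ?fV.
by rewrite exponent_sum_letter eq_sym (negPf nx) mulr0z.
Qed.

(** * Homology classes in characteristic p *)

Lemma H1_classM (R : nzRingType) (G : groupType) (g h : G) :
  H1_class R (g * h)%g = H1_class R g + H1_class R h.
Proof.
rewrite /H1_class -[RHS]Quotient.pi_add; apply/eqP.
rewrite eq_sym -Quotient.idealrBE.
(* The boundary of the 2-chain [(g, h)] is [h - gh + g]. *)
apply/asboolP; exists << (g, h) >>.
rewrite (@bar_d2_widen _ _ [fset (g, h)]%fset) ?msuppU_le //.
by rewrite big_seq_fset1 mcoeffUU scale1r /= addrAC [<< h >> + _]addrC.
Qed.

(** [H1] carries only an additive structure, so the factor [p] is moved into the coefficient of the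
    chain, where it is zero. *)
Lemma H1_class_pchar (R : nzRingType) (p : nat) (G : groupType) (g : G) :
  p \in [pchar R] -> H1_class R g *+ p = 0.
Proof.
move=> pR.
pose f c : H1 R G := (\pi_(Quotient.quot (@boundary1 R G)) << c *g g >>)%qT.
have fD c d : f (c + d) = f c + f d by rewrite -[RHS]Quotient.pi_add -monalgUD.
have f0 : f 0 = 0 by apply: (addrI (f 0)); rewrite -fD !addr0.
suff fMn m : f 1 *+ m = f m%:R.
  by rewrite -[H1_class R g]/(f 1) fMn (pcharf0 pR).
by elim: m => [|m IHm]; rewrite ?mulr0n ?f0 // mulrSr IHm -fD natr1.
Qed.

Lemma p_primitive_exponent_sum n p w : prime p -> p_primitive n p w ->
  exists i, ~~ (p %| `|exponent_sum w i|)%N.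
Proof.
move=> p_pr prim_w; apply/existsP; apply: contra_notT prim_w.
rewrite negb_exists => /forallP dvd_w.
rewrite (freeGroup_additive (@H1_classM 'F_p _)) big1 // => i _.
have := dvd_w i; rewrite negbK -[p]/`|p%:Z|%N -dvdzE => /dvdzP[q ->].
by rewrite mulrC mulrzA -pmulrn H1_class_pchar ?mul0rz ?pchar_Fp.
Qed.

(** * Affine maps over the regular representation *)

Section AffineRepresentation.
Variables (X : choiceType) (K : finGroupType) (k : X -> K) (c : K).
Hypothesis c_neq1 : c != 1%g.
Hypothesis c_comm : forall x, commute c (k x).
Variables (x0 x1 : X).
Hypothesis x01 : x1 != x0.
Hypothesis c_x0 : c \in <[k x0]>%g.

Let m := #|[set: K]|.
Let reg : K -> 'M[int]_m := regular_repr int [set: K]%G.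

Lemma regM g h : reg (g * h)%g = reg g *m reg h.
Proof. by rewrite /reg repr_mxM ?inE. Qed.

Lemma reg1 : reg 1%g = 1%:M.
Proof. exact: repr_mx1. Qed.

Lemma reg_inj : injective reg.
Proof.
move=> g h; have inj := mx_faithful_inj (regular_mx_faithful int [set: K]%G).
by apply: inj; rewrite inE.
Qed.

(** The norm element of [<[c]>]; its kernel is the lattice of admissible translations. *)
Definition sumc : 'M[int]_m := \sum_(a < #[c]%g) reg (c ^+ a)%g.

Lemma sumc_comm g : commute c g -> sumc *m reg g = reg g *m sumc.
Proof.
move=> cg; rewrite mulmx_suml mulmx_sumr; apply: eq_bigr => a _.
by rewrite -!regM (commuteX a (commute_sym cg)).
Qed.

(** On a vector fixed by [c], [sumc] is multiplication by the order of [c], which is injective over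
    the integers. *)
Lemma sumc_fixed_eq0 g (u : 'cV_m) :
  c \in <[g]>%g -> sumc *m u = 0 -> reg g *m u = u -> u = 0.
Proof.
move=> /cycleP[j cgj] uE gu.
have gXu i : reg (g ^+ i)%g *m u = u.
  elim: i => [|i IHi]; first by rewrite reg1 mul1mx.
  by rewrite expgS regM -mulmxA IHi.
move: uE; rewrite mulmx_suml (eq_bigr (fun=> u)) => [|a _]; last first.
  by rewrite [X in reg (X ^+ a)]cgj -expgM gXu.
rewrite sumr_const card_ord => /eqP uE.
apply/colP => i; apply/eqP; move/eqP/colP/(_ i)/eqP: uE.
by rewrite !mxE mulmxnE mulrn_eq0 eqn0Ngt order_gt0.
Qed.

(** Multiplication by [c] permutes the terms of [sumc] cyclically. *)
Lemma sumcB1 : sumc *m (reg c - 1%:M) = 0.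
Proof.
rewrite mulmxBr mulmx1 mulmx_suml; apply/eqP; rewrite subr_eq0; apply/eqP.
under eq_bigr do rewrite -regM -expgSr.
rewrite /sumc; case def_d: #[c]%g (order_gt0 c) (expg_order c) => [//|d] _ cd1.
by rewrite big_ord_recr [RHS]big_ord_recl /= -def_d expg_order addrC.
Qed.

(** Homogeneous coordinates for the map sending [v] to [reg g *m v + t]. *)
Definition aff g (t : 'cV_m) : 'M[int]_(m + 1) := block_mx (reg g) t 0 1%:M.

Lemma affM g h t s : aff g t *m aff h s = aff (g * h)%g (reg g *m s + t).
Proof.
by rewrite /aff mulmx_block regM !mulmx0 !mul0mx !mulmx1 !addr0 ?mulmx1 add0r.
Qed.

Lemma aff1 : aff 1%g 0 = 1%:M.
Proof. by rewrite /aff reg1 -scalar_mx_block. Qed.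

Lemma aff_inj g h t s : aff g t = aff h s -> reg g = reg h /\ t = s.
Proof. by case/eq_block_mx. Qed.

Lemma aff_mulV g t : aff g t *m aff (g^-1)%g (- (reg (g^-1)%g *m t)) = 1%:M.
Proof.
by rewrite affM mulgV mulmxN mulmxA -regM mulgV reg1 mul1mx addNr aff1.
Qed.

Lemma aff_unit g t : aff g t \in unitmx.
Proof. by case: (mulmx1_unit (aff_mulV g t)). Qed.

(** By [sumcB1] the columns of [reg c - 1%:M] lie in the kernel of [sumc]. As [reg] is faithful and
    [c] nontrivial, the default 0 never occurs. *)
Definition translation : 'cV[int]_m :=
  if [pick j | col j (reg c - 1%:M) != 0] is Some j
  then col j (reg c - 1%:M) else 0.

Lemma translation_neq0 : translation != 0.
Proof.
rewrite /translation; case: pickP => // c1; case/eqP: c_neq1.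
apply: reg_inj; rewrite reg1; apply/eqP; rewrite -subr_eq0.
apply/eqP/matrixP=> i j.
by move/(_ j)/eqP/colP/(_ i): c1; rewrite !mxE.
Qed.

Lemma sumc_translation : sumc *m translation = 0.
Proof.
rewrite /translation; case: pickP => [j _|_]; last by rewrite mulmx0.
by rewrite colE mulmxA sumcB1 mul0mx.
Qed.

Definition gen_shift x : 'cV[int]_m := if x == x1 then translation else 0.

Definition affine_gen x : GL (m + 1) int :=
  MkGL (aff_unit (k x) (gen_shift x)).

Definition affine_rep : freeGroup X -> GL (m + 1) int := fg_lift affine_gen.

(** The kernel of [sumc] is stable under the image of [k], which commutes with [c], so translation
    parts never leave it. *)
Lemma affine_repP w :
  exists2 t, sumc *m t = 0 & affine_rep w = aff (fg_lift k w) t :> 'M_(m + 1).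
Proof.
elim/freeGroup_ind: w => [|a w [t Et w_t]].
  by exists 0; rewrite ?mulmx0 ?aff1.
have [s Es a_s] : exists2 s, sumc *m s = 0 &
    fg_lift_letter affine_gen a = aff (fg_lift_letter k a) s :> 'M_(m + 1).
  have Ex x : sumc *m (gen_shift x) = 0.
    rewrite /gen_shift; case: ifP => _; last exact: mulmx0.
    exact: sumc_translation.
  case: a => x [] /=; last by exists (gen_shift x).
  exists (- (reg (k x)^-1%g *m gen_shift x)).
    rewrite mulmxN mulmxA sumc_comm; last exact/commuteV/c_comm.
    by rewrite -mulmxA Ex mulmx0 oppr0.
  rewrite /= -[LHS]mulmx1 -(aff_mulV (k x) (gen_shift x)).
  by rewrite mulmxA mulVmx ?aff_unit // mul1mx.
have -> : affine_rep (fg_letter a * w)%g =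
    (fg_lift_letter affine_gen a * affine_rep w)%g.
  by rewrite /affine_rep fg_liftM fg_liftE.
have -> : fg_lift k (fg_letter a * w)%g = (fg_lift_letter k a * fg_lift k w)%g.
  by rewrite fg_liftM fg_liftE.
exists (reg (fg_lift_letter k a) *m t + s); last by rewrite /= a_s w_t affM.
rewrite mulmxDr Es addr0 mulmxA sumc_comm; last first.
  by case: a {Es a_s} => x [] /=; [apply: commuteV|]; apply: c_comm.
by rewrite -mulmxA Et mulmx0.
Qed.

Lemma affine_rep_finite_order w :
  c \in <[fg_lift k w]>%g -> has_finite_order (affine_rep w).
Proof.
move=> cw; exists #[fg_lift k w]%g; split; first exact: order_gt0.
set N := #[_]%g.
have [t Et w_t] := affine_repP w.
have [s Es wN_s] := affine_repP (w ^+ N)%g.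
have repX i : affine_rep (w ^+ i)%g = (affine_rep w ^+ i)%g by exact: gmulfXn.
have wN : fg_lift k (w ^+ N)%g = 1%g.
  by rewrite gmulfXn -[LHS]/(fg_lift k w ^+ #[_])%g expg_order.
(* As [w ^+ N] has trivial linear part, comparing translation parts shows that [s] is fixed by the
   linear part of [w]. *)
have : affine_rep w *m affine_rep (w ^+ N)%g =
    affine_rep (w ^+ N)%g *m affine_rep w.
  rewrite repX -[LHS]/(GL_mx (affine_rep w * affine_rep w ^+ N)%g).
  by rewrite -expgS expgSr.
rewrite w_t wN_s wN !affM => /aff_inj[_].
rewrite reg1 mul1mx [t + s]addrC => /addIr ws.
have s0 := sumc_fixed_eq0 cw Es ws.
by rewrite -repX; apply: val_inj; rewrite /= wN_s wN s0 aff1.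
Qed.

Lemma affine_rep_infinite : infinite_set (range affine_rep).
Proof.
case/finite_seqP => s0 rep_s0; pose s := undup s0.
have mem_s A : reflect (exists w, affine_rep w = A) (A \in s).
  rewrite mem_undup; apply: (iffP idP) => [sA|[w <-]].
    have : range affine_rep A by rewrite rep_s0.
    by case=> w _ <-; exists w.
  have : range affine_rep (affine_rep w) by exists w.
  by rewrite rep_s0.
pose transl (A : GL (m + 1) int) : 'cV[int]_m := ursubmx (A : 'M_(m + 1)).
(* [transl A] is the image of the origin under [A], so [S] is [size s] times the barycentre of these
   images, a fixed point; summing avoids division. *)
pose S := \sum_(A <- s) transl A.
have ES : sumc *m S = 0.
  rewrite mulmx_sumr big_seq big1 // => A /mem_s[w <-].
  by have [t Et w_t] := affine_repP w; rewrite /transl w_t block_mxKur.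
have Sx x : S = reg (k x) *m S + gen_shift x *+ size s.
  (* Left multiplication by a generator permutes the finite image. *)
  have perm_s : perm_eq s [seq (affine_gen x * A)%g | A <- s].
    have gen_x w :
        affine_rep (fg_gen x * w)%g = (affine_gen x * affine_rep w)%g.
      by rewrite /affine_rep fg_liftM fg_liftE.
    apply: uniq_perm; rewrite ?map_inj_uniq ?undup_uniq //; first exact: mulgI.
    move=> A; apply/mem_s/mapP => [[w <-]|[B /mem_s[w <-] ->]]; last first.
      by exists (fg_gen x * w)%g.
    exists (affine_rep ((fg_gen x)^-1 * w)%g); first by apply/mem_s; eexists.
    by rewrite -gen_x mulVKg.
  rewrite {1}/S (perm_big _ perm_s) big_map mulmx_sumr.
  rewrite (_ : gen_shift x *+ _ = \sum_(A <- s) gen_shift x); last first.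
    by rewrite big_const_seq count_predT iter_addr_0.
  rewrite -big_split; apply: eq_big_seq => A /mem_s[w <-] /=.
  have [t _ w_t] := affine_repP w.
  by rewrite /transl /= w_t affM !block_mxKur.
(* The generator [x0] acts linearly, so it fixes [S] itself. *)
have S0 : S = 0.
  apply: (sumc_fixed_eq0 c_x0) => //.
  by rewrite [RHS](Sx x0) /gen_shift eq_sym (negPf x01) mul0rn addr0.
have := Sx x1; rewrite S0 mulmx0 add0r /gen_shift eqxx => /esym/eqP.
have s_gt0 : (0 < size s)%N.
  have /mem_s : exists w, affine_rep w = 1%g by exists 1%g; exact: gmulf1.
  by case: (s).
move=> t0; case/eqP: translation_neq0; apply/colP => i.
move/eqP/colP/(_ i)/eqP: t0.
by rewrite mulmxnE mxE mulrn_eq0 eqn0Ngt s_gt0 => /eqP.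
Qed.

End AffineRepresentation.

(** * Leading superdiagonals of upper triangular matrices *)

Section Superdiagonal.
Variables (R : nzRingType) (D : nat).
Implicit Types (M N : 'M[R]_D.+1) (a b : nat -> R) (r s : nat).

(** Entries beyond the leading superdiagonal stay free; [a] lives on all of [nat] so that shifted
    row indices need no bound. *)
Definition superdiag r a N := forall i j : 'I_D.+1,
  ((j < i + r)%N -> N i j = 0) /\ (j = (i + r)%N :> nat -> N i j = a i).

Lemma eq_superdiag r a b N : a =1 b -> superdiag r a N -> superdiag r b N.
Proof. by move=> ab aN i j; rewrite -ab. Qed.

Lemma superdiagD r a b M N :
  superdiag r a M -> superdiag r b N -> superdiag r (fun i => a i + b i) (M + N).
Proof.
move=> aM bN i j; rewrite mxE; have [M0 Ma] := aM i j; have [N0 Nb] := bN i j.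
by split=> [lt|eq]; [rewrite M0 ?N0 ?addr0 | rewrite Ma ?Nb].
Qed.

Lemma superdiag_widen r s a N :
  (s < r)%N -> superdiag r a N -> superdiag s (fun=> 0) N.
Proof.
move=> sr aN i j; have [N0 _] := aN i j.
split=> ji; apply: N0; rewrite ?ji ?ltn_add2l //.
by rewrite (leq_trans ji) // leq_add2l ltnW.
Qed.

(** On superdiagonal [r + s] only the middle index [i + r] contributes; below it none does. *)
Lemma superdiagM r s a b M N : superdiag r a M -> superdiag s b N ->
  superdiag (r + s) (fun i => a i * b (i + r)%N) (M *m N).
Proof.
move=> aM bN i j; rewrite mxE.
have vanish (l : 'I_D.+1) : (l != i + r :> nat)%N ->
    (j <= i + (r + s))%N -> M i l * N l j = 0.
  rewrite neq_ltn => /orP[lt_l _|gt_l le_j].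
    by rewrite (aM i l).1 // mul0r.
  by rewrite (bN l j).1 ?mulr0 // (leq_ltn_trans le_j) // addnA ltn_add2r.
split=> [lt_j|eq_j].
  apply: big1 => l _.
  have [eq_l|/vanish->//] := eqVneq (l : nat) (i + r)%N; last exact: ltnW.
  by rewrite (bN l j).1 ?mulr0 // eq_l -addnA.
have lt_ir : (i + r < D.+1)%N.
  by rewrite (leq_ltn_trans _ (ltn_ord j)) // eq_j addnA leq_addr.
rewrite (bigD1 (Ordinal lt_ir)) //= big1 => [|l ne_l]; last first.
  by rewrite vanish ?eq_j.
by rewrite addr0 (aM _ _).2 // (bN _ _).2 //= eq_j addnA.
Qed.

Lemma superdiag0 r a N : superdiag r a N -> (D < r)%N -> N = 0.
Proof.
move=> aN Dr; apply/matrixP => i j; rewrite (aN i j).1 ?mxE //.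
by rewrite (leq_trans (ltn_ord j)) // (leq_trans Dr) // leq_addl.
Qed.

Lemma superdiag1 : superdiag 0 (fun=> 1) (1 : 'M[R]_D.+1).
Proof.
move=> i j; rewrite addn0 !mxE; split=> [lt_ji|/val_inj->]; last by rewrite eqxx.
by rewrite -val_eqE gtn_eqF.
Qed.

Lemma superdiagX a N r : superdiag 1 a N ->
  superdiag r (fun i => \prod_(i <= l < i + r) a l) (N ^+ r).
Proof.
move=> aN; elim: r => [|r IHr] i j.
  rewrite expr0 big_geq ?addn0 //.
  by have := superdiag1 i j; rewrite addn0.
have [lt_j eq_j] := superdiagM aN IHr i j; rewrite exprS -add1n.
split=> // /eq_j ->; rewrite [RHS]big_ltn; last by rewrite addnS ltnS leq_addr.
by rewrite addn1 addSnnS.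
Qed.

Lemma superdiag_corner a N :
  superdiag D a N -> N = a 0%N *: delta_mx ord0 ord_max.
Proof.
move=> aN; apply/matrixP => i j; rewrite !mxE.
have le_jD : (j <= D)%N by rewrite -ltnS.
have [->|i_neq0] := eqVneq i ord0.
  have [->|j_neq] := eqVneq j ord_max; first by rewrite (aN _ _).2 // mulr1.
  by rewrite (aN _ j).1 ?mulr0 // ltn_neqAle le_jD j_neq.
rewrite (aN i j).1 ?mulr0 // (leq_ltn_trans le_jD) //.
by rewrite -[X in (X < _)%N]add0n ltn_add2r lt0n.
Qed.

End Superdiagonal.

(** * Characteristic p and finite fields *)

Lemma pchar_mx (R : fieldType) n p :
  p \in [pchar R] -> p \in [pchar 'M[R]_n.+1].
Proof. by rewrite pchar_lalg. Qed.

Lemma exprDn_pchar_comm (R : nzRingType) p e (x y : R) :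
  p \in [pchar R] -> GRing.comm x y ->
  (x + y) ^+ (p ^ e) = x ^+ (p ^ e) + y ^+ (p ^ e).
Proof.
move=> pR xy; elim: e => [|e IHe]; first by rewrite expn0 !expr1.
rewrite expnSr !exprM IHe -!(pFrobenius_autE pR) pFrobenius_autD_comm //.
exact/commrX/commr_sym/commrX/commr_sym.
Qed.

(** ['X^p - 'X] has at most [p] roots, and the images of 0, ..., p - 1 are already [p] distinct
    ones. *)
Lemma prime_subfield (R : idomainType) p (x : R) :
  p \in [pchar R] -> x ^+ p = x -> exists b, x = b%:R.
Proof.
move=> pR xp; have p_pr := pcharf_prime pR; have p_gt1 := prime_gt1 p_pr.
have [/mapP[b _ ->]|x_nin] := boolP (x \in [seq b%:R | b <- iota 0 p]).
  by exists b.
have size_P : size ('X^p - 'X : {poly R}) = p.+1.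
  by rewrite size_polyDl ?size_polyXn // size_polyN size_polyX ltnS.
have P0 : 'X^p - 'X != 0 :> {poly R} by rewrite -size_poly_gt0 size_P.
have := @max_poly_roots _ _ (x :: [seq b%:R | b <- iota 0 p]) P0.
rewrite size_P /= size_map size_iota ltnn => abs; suff: false by []; apply: abs.
  rewrite rootE !hornerE xp subrr eqxx; apply/allP => _ /mapP[b _ ->].
  by rewrite rootE !hornerE -(pFrobenius_autE pR) pFrobenius_aut_nat subrr.
rewrite x_nin map_inj_in_uniq ?iota_uniq // => b d.
rewrite !mem_iota !add0n /=.
wlog le_bd : b d / (b <= d)%N.
  by move=> W b_p d_p bd; have [/W->|/ltnW/W->] := leqP b d.
move=> b_p d_p bd; apply/eqP; rewrite eqn_leq le_bd /= leqNgt.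
apply/negP => lt_bd; move/eqP: bd.
rewrite eq_sym -subr_eq0 -natrB // -(dvdn_pcharf pR).
move/(dvdn_leq _); rewrite subn_gt0 lt_bd => /(_ isT).
by rewrite leqNgt (leq_ltn_trans (leq_subr _ _)).
Qed.

(** The [e i] are the first [n] vectors of a basis of [L] over the prime field; an integer relation
    is read modulo [p]. *)
Lemma finField_Fp_free p d n : prime p -> (0 < d)%N -> (n <= d)%N ->
  exists (L : finFieldType) (e : 'I_n -> L),
  [/\ p \in [pchar L], #|L| = (p ^ d)%N &
      forall z : 'I_n -> int,
        \sum_i e i *~ z i = 0 -> forall i, (p %| `|z i|)%N].
Proof.
move=> p_pr d_gt0 le_nd; have [L pL cardL] := pPrimePowerField p_pr d_gt0.
pose V := pPrimeCharType pL; pose b := vbasis {:V}.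
have size_b : size (take n b) == n.
  by rewrite size_takel // size_tuple pprimeChar_dimf cardL pfactorK.
have /freeP free_b : free (Tuple size_b).
  apply: (catl_free (Y := drop n b)); rewrite /= cat_take_drop.
  exact: basis_free (vbasisP {:V}).
exists L, (fun i => (take n b)`_i); split=> // z z0 i.
suff: (p%:Z %| z i)%Z by rewrite dvdzE.
rewrite (dvdz_pcharf (pchar_Fp p_pr)).
apply/eqP; apply: (free_b (fun j => (z j)%:~R)); rewrite -[RHS]z0.
by apply: eq_bigr => j _; rewrite scaler_int.
Qed.

(** * Unipotent matrices with a Frobenius orbit on the superdiagonal *)

Section Unipotent.
Variables (p k : nat) (L : finFieldType).
Let D := (p ^ k)%N.
Hypotheses (p_pr : prime p) (pL : p \in [pchar L]) (cardL : #|L| = (p ^ D)%N).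
Let E : 'M[L]_D.+1 := delta_mx ord0 ord_max.

Definition unipotent_super (x : L) (A : 'M[L]_D.+1) :=
  superdiag 1 (fun i => x ^+ (p ^ i)) (A - 1).

Let pM : p \in [pchar 'M[L]_D.+1]. Proof. exact: pchar_mx. Qed.

Lemma exprD_pX e (x y : L) : (x + y) ^+ (p ^ e) = x ^+ (p ^ e) + y ^+ (p ^ e).
Proof. by apply: exprDn_pchar_comm; [exact: pL | exact: mulrC]. Qed.

(** [(A - 1) * (B - 1)] starts on the second superdiagonal, so the first ones add, and Frobenius is
    additive. *)
Lemma unipotent_superM x y A B : unipotent_super x A -> unipotent_super y B ->
  unipotent_super (x + y) (A * B).
Proof.
move=> Ax By; rewrite /unipotent_super.
have -> : A * B - 1 = (A - 1) + (B - 1) + (A - 1) * (B - 1).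
  rewrite -{1}[A](subrK 1) -{1}[B](subrK 1) mulrDl mulrDr mulr1 mul1r.
  by rewrite [RHS]addrC !addrA addrK.
have AB0 := superdiag_widen (ltnSn 1) (superdiagM Ax By).
apply: eq_superdiag (superdiagD (superdiagD Ax By) AB0).
by move=> i; rewrite addr0 exprD_pX.
Qed.

Lemma unipotent_super1 : unipotent_super 0 1.
Proof.
rewrite /unipotent_super subrr => i j; rewrite mxE; split=> // _.
by rewrite expr0n expn_eq0 eqn0Ngt prime_gt0.
Qed.

Lemma unipotent_pX x A e :
  unipotent_super x A -> A ^+ (p ^ e) = 1 + (A - 1) ^+ (p ^ e).
Proof.
move=> Ax; rewrite -{1}[A](subrK 1) addrC (exprDn_pchar_comm _ pM) ?expr1n //.
exact/commr_sym/commr1.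
Qed.

(** [p ^ k.+1] exceeds [D], so this power of the nilpotent part vanishes. *)
Lemma unipotent_order x A : unipotent_super x A -> A ^+ (p ^ k.+1) = 1.
Proof.
move=> Ax; rewrite (unipotent_pX _ Ax) (superdiag0 (superdiagX _ Ax)) ?addr0 //.
by rewrite ltn_exp2l ?prime_gt1.
Qed.

Lemma unipotent_unit x A : unipotent_super x A -> A \is a GRing.unit.
Proof.
move=> Ax; have q_gt0 : (0 < p ^ k.+1)%N by rewrite expn_gt0 prime_gt0.
by rewrite -(unitrX_pos _ q_gt0) (unipotent_order Ax) unitr1.
Qed.

(** The inverse is a positive power of [A], so closure under products suffices. *)
Lemma unipotent_superV x A : unipotent_super x A -> unipotent_super (- x) A^-1.
Proof.
move=> Ax.
have q_gt0 : (0 < p ^ k.+1)%N by rewrite expn_gt0 prime_gt0.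
have UA := unipotent_unit Ax.
have -> : A^-1 = A ^+ (p ^ k.+1).-1.
  by apply: (mulrI UA); rewrite divrr // -exprS prednK // (unipotent_order Ax).
have -> : - x = x *+ (p ^ k.+1).-1.
  apply: (addrI x); rewrite subrr -mulrS prednK // expnS mulrnA (mulrn_pchar pL).
  by rewrite mul0rn.
elim: _.-1 => [|i IHi]; first exact: unipotent_super1.
by rewrite exprS mulrS; apply: unipotent_superM.
Qed.

Definition unipotent_gen (x : L) : 'M[L]_D.+1 :=
  1 + \matrix_(i, j) (if j == i.+1 :> nat then x ^+ (p ^ i) else 0).

Lemma unipotent_genP x : unipotent_super x (unipotent_gen x).
Proof.
rewrite /unipotent_super /unipotent_gen addrC addKr => i j; rewrite mxE addn1.
by split=> [/ltn_eqF->|->]; rewrite ?eqxx.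
Qed.

Lemma corner_superdiag y : superdiag D (fun=> y) (y *: E).
Proof.
move=> i j; rewrite !mxE; split=> [ltj|eqj].
  case: eqP => [i0|]; rewrite ?mulr0 //; case: eqP => [jm|]; rewrite ?mulr0 //.
  by rewrite jm i0 ltnn in ltj.
have /eqP i0 : i == ord0.
  rewrite -val_eqE /= -leqn0 -(leq_add2r D) -eqj add0n -ltnS; exact: ltn_ord.
rewrite i0 eqxx (_ : j == ord_max) ?mulr1 //.
by apply/eqP/val_inj; rewrite /= eqj i0.
Qed.

Let D_gt0 : (0 < D)%N. Proof. by rewrite expn_gt0 prime_gt0. Qed.

(** [E] squares to zero because [D] is positive. *)
Lemma cornerX y b : (1 + y *: E) ^+ b = 1 + (y *+ b) *: E.
Proof.
elim: b => [|b IHb]; first by rewrite expr0 mulr0n scale0r addr0.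
rewrite exprS IHb mulrDl mul1r mulrDr mulr1 -scalerAl -scalerAr.
rewrite [E * E]mul_delta_mx_cond -val_eqE /= gtn_eqF ?D_gt0 //.
by rewrite !scaler0 addr0 -addrA -scalerDl [_ + y]addrC mulrS.
Qed.

Lemma corner_unit : 1 + E \is a GRing.unit.
Proof.
rewrite -(unitrX_pos _ (prime_gt0 p_pr)) -[E]scale1r cornerX.
by rewrite (pcharf0 pL) scale0r addr0 unitr1.
Qed.

(** Both products of [E] with [A - 1] start on superdiagonal [D + 1], outside the matrix. *)
Lemma corner_comm x A : unipotent_super x A -> (1 + E) * A = A * (1 + E).
Proof.
move=> Ax; have EE : superdiag D (fun=> 1) E.
  by have := corner_superdiag 1; rewrite scale1r.
rewrite mulrDl mulrDr mul1r mulr1; congr (_ + _).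
apply/eqP; rewrite -subr_eq0; apply/eqP.
transitivity (E * (A - 1) - (A - 1) * E).
  by rewrite mulrBl mulrBr mul1r mulr1 opprB addrA subrK.
rewrite [E * _](superdiag0 (superdiagM EE Ax)) ?addn1 //.
by rewrite [_ * E](superdiag0 (superdiagM Ax EE)) ?subr0.
Qed.

(* The product is the norm of [x] over the prime field of [L]. *)
Lemma norm_Fp (x : L) : x != 0 ->
  exists2 b, b%:R != 0 :> L & (\prod_(0 <= l < D) x ^+ (p ^ l))^-1 = b%:R.
Proof.
move=> x0; set y := \prod_(_ <= _ < _) _.
have y0 : y != 0.
  by rewrite prodf_seq_neq0; apply/allP => l _; rewrite expf_neq0.
(* Frobenius permutes the factors cyclically, since [x ^+ (p ^ D) = x] in [L]. *)
have yp : y ^+ p = y.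
  rewrite /y -prodrXl; under eq_bigr do rewrite -exprM -expnSr.
  rewrite -(prednK D_gt0) big_nat_recr // big_nat_recl //=.
  by rewrite prednK ?D_gt0 // -cardL expf_card expn0 expr1 mulrC.
have [|b y_b] := prime_subfield (x := y^-1) pL; first by rewrite exprVn yp.
by exists b; rewrite -?y_b ?invr_eq0.
Qed.

(** [A ^+ D] is 1 plus the norm of [x] in the corner; [b] represents the inverse of that norm, so a
    further [b]-th power makes the corner entry 1. *)
Lemma corner_cycle x A :
  x != 0 -> unipotent_super x A -> exists i, A ^+ i = 1 + E.
Proof.
move=> x0 Ax; have [b b0 Nb] := norm_Fp x0; exists (D * b)%N.
have AD := superdiag_corner (superdiagX D Ax).
rewrite exprM (unipotent_pX _ Ax) AD cornerX add0n -mulr_natr -Nb.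
rewrite divff ?scale1r //.
by move: b0; rewrite -Nb invr_eq0.
Qed.

End Unipotent.

(** * The finite group and the resulting representation *)

Lemma finite_quotient p n : prime p ->
  exists (K : finGroupType) (g : 'I_n -> K) (c : K),
  [/\ c != 1%g, forall i, commute c (g i) &
      forall w, (exists i, ~~ (p %| `|exponent_sum w i|)%N) ->
        c \in <[fg_lift g w]>%g].
Proof.
(* A power of [p] makes [D]-th powers additive on commuting matrices; [D] at least [n] leaves room
   for [n] independent elements. *)
move=> p_pr; set D := (p ^ n)%N.
have le_nD : (n <= D)%N by rewrite ltnW // ltn_expl ?prime_gt1.
have D_pos : (0 < D)%N by rewrite expn_gt0 prime_gt0.
have [L [e [pL cardL free_e]]] := finField_Fp_free p_pr D_pos le_nD.
have gen_unit i :=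
  unipotent_unit p_pr pL (unipotent_genP (p := p) (k := n) (e i)).
(* The group is the full unit group of the matrix ring, so [c] is only claimed to commute with the
   generators' images. *)
pose g i := FinRing.unit _ (gen_unit i).
pose c := FinRing.unit _ (corner_unit n p_pr pL).
exists _, g, c.
(* By independence of the [e i], [lam w] vanishes only if [p] divides every exponent sum of [w]. *)
pose lam w := \sum_i e i *~ exponent_sum w i.
have lam_w w : unipotent_super (lam w) (val (fg_lift g w)).
  elim/freeGroup_ind: w => [|a w IHw].
    rewrite /lam big1 => [|i _]; last by rewrite /exponent_sum big_nil mulr0z.
    exact: unipotent_super1.
  have -> : lam (fg_letter a * w)%g = lam (fg_letter a) + lam w.
    rewrite /lam -big_split; apply: eq_bigr => i _.
    by rewrite exponent_sumM mulrzDr.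
  rewrite fg_liftM; apply: unipotent_superM => //.
  have -> : lam (fg_letter a) = e a.1 *~ (-1) ^+ a.2.
    rewrite /lam (bigD1 a.1) //= exponent_sum_letter eqxx.
    rewrite big1 ?addr0 // => j ne_j.
    by rewrite exponent_sum_letter eq_sym (negPf ne_j).
  rewrite fg_liftE; case: a => i [] /=; last exact: unipotent_genP.
  by apply: unipotent_superV => //; apply: unipotent_genP.
split.
- apply/eqP => /(congr1 val)/matrixP/(_ ord0 ord_max)/eqP.
  by rewrite /= !mxE !eqxx -val_eqE /= (ltn_eqF D_pos) add0r oner_eq0.
- move=> i; apply/val_inj/(corner_comm (unipotent_genP (e i))).
move=> w [i ndiv_i].
have lam0 : lam w != 0 by apply: contraNneq ndiv_i => lam0; apply: free_e.
have [m wm] := corner_cycle p_pr pL cardL lam0 (lam_w w).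
by apply/cycleP; exists m; apply: val_inj; rewrite FinRing.val_unitX wm.
Qed.

Local Open Scope classical_set_scope.

Theorem theorem7 (n : nat) (hn : (2 <= n)%N) (p : nat) (hp : prime p) :
  exists (d : nat) (rho : {multiplicative freeGroup 'I_n -> GL d int}),
    [/\ (1 <= d)%N,
        infinite_set (range rho) &
        forall g : GL d int, (rho @` p_primitive n p) g -> has_finite_order g].
Proof.
have [K [k [c [c_neq1 c_comm c_cycle]]]] := @finite_quotient p n hp.
pose x0 : 'I_n := Ordinal (ltnW hn); pose x1 : 'I_n := Ordinal hn.
(* A generator has exponent sum 1 in itself, which is prime to [p]. *)
have c_x0 : c \in <[k x0]>%g.
  rewrite -[k x0]/(fg_lift_letter k (x0, false)) -fg_liftE; apply: c_cycle.
  by exists x0; rewrite exponent_sum_letter eqxx dvdn1 gtn_eqF ?prime_gt1.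
exists _, (fg_lift (affine_gen k c x1)); split.
- by rewrite addn1.
- exact: (affine_rep_infinite c_neq1 c_comm _ c_x0).
- move=> _ [w /(p_primitive_exponent_sum hp)/c_cycle c_w <-].
  exact: affine_rep_finite_order.
Qed.
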